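(* Let $w_1,w_2,w_3$ be any positive integers. Then for every integer $n\ge 0$ and every $y\in\mathbb{Z}_p$ (sums running over nonnegative integers $k,l,m$ with $k+l+m=n$): \begin{align*} &\sum_{k+l+m=n}\binom{n}{k,l,m}B_{k,\chi,\xi^{w_3}}(w_1y)\,B_{l,\chi,\xi^{w_1}}(w_2y)\,B_{m,\chi,\xi^{w_2}}(w_3y)\,w_3^{k}w_1^{l}w_2^{m}\\ =&\sum_{k+l+m=n}\binom{n}{k,l,m}B_{k,\chi,\xi^{w_2}}(w_1y)\,B_{l,\chi,\xi^{w_1}}(w_3y)\,B_{m,\chi,\xi^{w_3}}(w_2y)\,w_2^{k}w_1^{l}w_3^{m}. \end{align*}
   Context: Let $p$ be a fixed prime, $\mathbb{Z}_p$ the ring of $p$-adic integers, and $\mathbb{C}_p$ the completion of an algebraic closure of $\mathbb{Q}_p$. Let $\Gamma_r=\{\xi\in\mathbb{C}_p : \xi^{p^s}=1 \text{ for some } s\in\mathbb{Z}_{>0}\}$ (ramified roots of unity) and fix any $\xi\in\Gamma_r$. Let $d$ be a fixed positive integer and $\chi$ a (primitive) Dirichlet character of conductor $d$, viewed as a function $\mathbb{Z}\to\mathbb{C}_p$ via a fixed embedding $\overline{\mathbb{Q}}\to\mathbb{C}_p$ (periodic mod $d$, zero on integers not coprime to $d$; if $d=1$, $\chi\equiv 1$). For $\eta\in\Gamma_r$, the generalized twisted Bernoulli polynomials $B_{n,\chi,\eta}(x)$ attached to $\chi$ and $\eta$ are the polynomials in $x$ with coefficients in $\mathbb{C}_p$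 defined by the power series expansion in $t$ $$\frac{te^{xt}}{\eta^{d}e^{dt}-1}\sum_{a=0}^{d-1}\chi(a)\eta^{a}e^{at}=\sum_{n=0}^{\infty}B_{n,\chi,\eta}(x)\frac{t^n}{n!}.$$ Also $\binom{n}{k,l,m}=\frac{n!}{k!\,l!\,m!}$. *)

(* Defs.v *)
From HB Require Import structures.
From mathcomp Require Import all_boot all_order all_algebra all_field.
From mathcomp Require Import boolp reals.

Set Implicit Arguments.
Unset Strict Implicit.
Unset Printing Implicit Defensive.

Import Order.TTheory GRing.Theory Num.Theory.
Local Open Scope ring_scope.

(** * The field of p-adic complex numbers *)

Section AbsoluteValues.
Variable R : realType.

Definition is_abs_value (K : fieldType) (v : K -> R) : Prop :=
  [/\ forall x, 0 <= v x,
      forall x, v x = 0 <-> x = 0,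
      forall x y, v (x * y) = v x * v y &
      forall x y, v (x + y) <= v x + v y].

Definition abs_complete (K : fieldType) (v : K -> R) : Prop :=
  forall u : nat -> K,
    (forall e : R, 0 < e -> exists N : nat, forall i j : nat,
        (N <= i)%N -> (N <= j)%N -> v (u i - u j) < e) ->
    exists l : K, forall e : R, 0 < e -> exists N : nat, forall i : nat,
        (N <= i)%N -> v (u i - l) < e.

Definition is_completion (F K : fieldType) (vF : F -> R) (vK : K -> R)
    (f : F -> K) : Prop :=
  [/\ is_abs_value vK,
      abs_complete vK,
      forall x, vK (f x) = vF x &
      forall (z : K) (e : R), 0 < e -> exists x : F, vK (z - f x) < e].

Definition padic_abs (p : nat) (x : rat) : R :=
  if x == 0 then 0
  else p%:R ^+ logn p `|denq x|%N / p%:R ^+ logn p `|numq x|%N.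

End AbsoluteValues.

(** The library has neither Q_p nor C_p. Each of the three steps
    Q -> Q_p -> (an algebraic closure of Q_p) -> C_p is determined up to
    isometric isomorphism by the property that introduces it, so a
    [padic_complex R p] is a copy of C_p, unique up to isomorphism. *)
Record padic_complex (R : realType) (p : nat) := PadicComplex {
  Qp : fieldType;
  Qp_abs : Qp -> R;
  Qp_of_rat : {rmorphism rat -> Qp};
  Qp_completion : is_completion (@padic_abs R p) Qp_abs Qp_of_rat;

  Qpbar : closedFieldType;
  Qpbar_abs : Qpbar -> R;
  Qpbar_of_Qp : {rmorphism Qp -> Qpbar};
  Qpbar_algebraic : forall z, algebraicOver Qpbar_of_Qp z;
  Qpbar_is_abs : is_abs_value Qpbar_abs;
  Qpbar_abs_ext : forall x, Qpbar_abs (Qpbar_of_Qp x) = Qp_abs x;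

  Cp : fieldType;
  Cp_abs : Cp -> R;
  Cp_of_Qpbar : {rmorphism Qpbar -> Cp};
  Cp_completion : is_completion Qpbar_abs Cp_abs Cp_of_Qpbar
}.

Definition Cp_of_Qp (R : realType) (p : nat) (C : padic_complex R p)
  (x : Qp C) : Cp C := Cp_of_Qpbar C (Qpbar_of_Qp C x).

Definition in_Zp (R : realType) (p : nat) (C : padic_complex R p)
  (y : Cp C) : Prop := exists2 x : Qp C, Qp_abs x <= 1 & y = Cp_of_Qp x.

Definition ramified_root (K : fieldType) (p : nat) (xi : K) : Prop :=
  exists2 s : nat, (0 < s)%N & xi ^+ (p ^ s) = 1.

(** * Dirichlet characters, with values in the algebraic numbers *)

Definition is_dirichlet_character (d : nat) (chi : int -> algC) : Prop :=
  [/\ forall a, chi (a + d%:Z) = chi a,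
      chi 1 = 1,
      forall a b, chi (a * b) = chi a * chi b &
      forall a, (chi a != 0) = coprimez a d%:Z].

Definition is_primitive_character (d : nat) (chi : int -> algC) : Prop :=
  is_dirichlet_character d chi /\
  forall (d' : nat) (chi' : int -> algC),
    (0 < d')%N -> (d' %| d)%N -> is_dirichlet_character d' chi' ->
    (forall a, coprimez a d%:Z -> chi a = chi' a) -> d' = d.

(** * Formal power series, as sequences of coefficients *)

Section PowerSeries.
Variable A : comNzRingType.
Implicit Types f g h : nat -> A.

Definition fps_mul f g : nat -> A :=
  fun n => \sum_(i < n.+1) f i * g (n - i)%N.

Definition fps_t : nat -> A := fun n => (n == 1%N)%:R.

Definition fps_one : nat -> A := fun n => (n == 0%N)%:R.

(** The quotient [f / g] is the series [h] with [g * h = f], when there is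
    one; see [gen_bernoulliP] and [gen_bernoulli_unique] for its existence
    and uniqueness where it is used. *)
Definition fps_div f g : nat -> A :=
  if pselect (exists h, fps_mul g h = f) is left ex_h
  then projT1 (cid ex_h) else fun=> 0.

End PowerSeries.

(** The series of [e^(c t)]. *)
Definition fps_exp (K : fieldType) (c : {poly K}) : nat -> {poly K} :=
  fun n => (n`!%:R)^-1 *: c ^+ n.

(** * Generalized twisted Bernoulli polynomials *)

Section GeneralizedBernoulli.
Variables (K : fieldType) (d : nat) (chi : int -> K) (eta : K).

(** The power series in [t] have coefficients in [K[x]]. *)
Definition bernoulli_num : nat -> {poly K} :=
  fps_mul (fps_mul (fps_t {poly K}) (fps_exp 'X))
    (fun n => \sum_(0 <= a < d)
       (chi a%:Z * eta ^+ a) *: fps_exp (a%:R : {poly K}) n).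

Definition bernoulli_den : nat -> {poly K} :=
  fun n => eta ^+ d *: fps_exp (d%:R : {poly K}) n - fps_one {poly K} n.

Definition gen_bernoulli (n : nat) : {poly K} :=
  n`!%:R *: fps_div bernoulli_num bernoulli_den n.

End GeneralizedBernoulli.

Section PowerSeriesDivision.
Variable A : idomainType.
Implicit Types f g h : nat -> A.

Fixpoint fps_quo_seq (m : nat) f g (n : nat) : seq A :=
  if n is k.+1 then
    let s := fps_quo_seq m f g k in
    rcons s ((g m)^-1 * (f (m + k)%N - \sum_(i < k) g (m + k - i)%N * s`_i))
  else [::].

Lemma size_fps_quo_seq m f g n : size (fps_quo_seq m f g n) = n.
Proof. by elim: n => //= n IHn; rewrite size_rcons IHn. Qed.

Lemma nth_fps_quo_seq m f g n i : (i < n)%N ->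
  (fps_quo_seq m f g n)`_i = (fps_quo_seq m f g i.+1)`_i.
Proof.
elim: n => // n IHn; rewrite ltnS leq_eqVlt => /predU1P[-> //|lt_in].
by rewrite [LHS]/= nth_rcons size_fps_quo_seq lt_in IHn.
Qed.

Lemma fps_mul_order m g h n : (forall i, (i < m)%N -> g i = 0) ->
  fps_mul g h (m + n)%N = \sum_(i < n.+1) g (m + i)%N * h (n - i)%N.
Proof.
move=> g0; rewrite /fps_mul -addnS big_split_ord /= big1 ?add0r; last first.
  by move=> i _; rewrite g0 ?mul0r.
by apply: eq_bigr => i _; rewrite subnDl.
Qed.

Lemma fps_quo_exists m f g : g m \is a GRing.unit ->
  (forall i, (i < m)%N -> g i = 0) -> (forall i, (i < m)%N -> f i = 0) ->
  exists h, fps_mul g h = f.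
Proof.
move=> gm_unit g0 f0; pose h i := (fps_quo_seq m f g i.+1)`_i.
exists h; apply/funext => N; have [lt_Nm|le_mN] := ltnP N m.
  rewrite f0 // /fps_mul big1 // => i _; rewrite g0 ?mul0r //.
  by rewrite (leq_trans _ lt_Nm) // ltnS -ltnS.
rewrite -(subnKC le_mN) fps_mul_order //; set k := (N - m)%N.
rewrite big_ord_recl addn0 subn0 {1}/h /=.
rewrite nth_rcons size_fps_quo_seq ltnn eqxx mulVKr //.
rewrite -[LHS]addrA -[RHS]addr0; congr (_ + _).
apply/eqP; rewrite addrC subr_eq0; apply/eqP.
rewrite [RHS](reindex_inj rev_ord_inj) /=; apply: eq_bigr => i _.
have lt_ik := ltn_ord i.
rewrite /bump /= add1n -addnBA ?leq_subr // subKn //.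
by rewrite [in RHS]nth_fps_quo_seq // ltn_subrL /= (leq_ltn_trans _ lt_ik).
Qed.

Lemma fps_mulI m g h h' : g m != 0 -> (forall i, (i < m)%N -> g i = 0) ->
  fps_mul g h = fps_mul g h' -> h = h'.
Proof.
move=> gm0 g0 eq_gh; apply/funext => n; elim/ltn_ind: n => n IHn.
have := congr1 (fun u => u (m + n)%N) eq_gh.
rewrite /= !fps_mul_order // !big_ord_recl addn0 subn0.
under eq_bigr => i _.
  rewrite IHn; last by rewrite ltn_subrL /= (leq_ltn_trans _ (ltn_ord i)).
  over.
by move/addIr/(mulfI gm0).
Qed.

End PowerSeriesDivision.

Section GeneralizedBernoulliTheory.
Variables (K : fieldType) (d : nat) (chi : int -> K) (eta : K).
Hypotheses (charK : [pchar K] =i pred0) (d_gt0 : (0 < d)%N).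

Lemma bernoulli_den_order : exists m,
  [/\ bernoulli_den d eta m \is a GRing.unit,
      forall i, (i < m)%N -> bernoulli_den d eta i = 0 &
      forall i, (i < m)%N -> bernoulli_num d chi eta i = 0].
Proof.
have D0 : bernoulli_den d eta 0 = (eta ^+ d - 1)%:P.
  by rewrite /bernoulli_den /fps_exp /fps_one fact0 invr1 scale1r expr0
             eqxx -mul_polyC mulr1 polyCB.
have D1 : bernoulli_den d eta 1 = (eta ^+ d * d%:R)%:P.
  by rewrite /bernoulli_den /fps_exp /fps_one subr0 invr1 scale1r expr1
             -mul_polyC polyCM polyC_natr.
have d0 : d%:R != 0 :> K.
  have /pcharf0P-> := charK; by rewrite -lt0n.
have [etad1|etad1] := eqVneq (eta ^+ d) 1.
  exists 1%N; rewrite D1 etad1 mul1r; split.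
  - by rewrite poly_unitE size_polyC d0 coefC /= unitfE.
  - by move=> [|//] _; rewrite D0 etad1 subrr.
  - move=> [|//] _; rewrite /bernoulli_num /fps_mul big_ord1 big_ord1.
    by rewrite /fps_t !mul0r.
exists 0%N; rewrite D0; split=> //.
by rewrite poly_unitE size_polyC coefC /= subr_eq0 etad1 unitfE subr_eq0.
Qed.

Lemma factK0 n : n`!%:R != 0 :> K.
Proof. by have /pcharf0P-> := charK; rewrite -lt0n fact_gt0. Qed.

Lemma gen_bernoulliP :
  fps_mul (bernoulli_den d eta)
    (fun n => (n`!%:R)^-1 *: gen_bernoulli d chi eta n) =
  bernoulli_num d chi eta.
Proof.
rewrite /gen_bernoulli; under eq_fun do rewrite scalerA mulVf ?factK0 // scale1r.
have [m [Du D0 N0]] := bernoulli_den_order.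
rewrite /fps_div; case: pselect => [ex_h|[]]; first by case: cid.
exact: fps_quo_exists Du D0 N0.
Qed.

Lemma gen_bernoulli_unique (B : nat -> {poly K}) :
  fps_mul (bernoulli_den d eta) (fun n => (n`!%:R)^-1 *: B n) =
  bernoulli_num d chi eta -> B = gen_bernoulli d chi eta.
Proof.
have [m [Du D0 N0]] := bernoulli_den_order.
have Dm0 : bernoulli_den d eta m != 0.
  by apply: contraTneq Du => ->; rewrite unitr0.
rewrite -gen_bernoulliP => /(fps_mulI Dm0 D0) eqB; apply/funext => n.
have /(congr1 (fun u => n`!%:R *: u)) := congr1 (fun u => u n) eqB.
move: (gen_bernoulli _ _ _ n) => c.
by rewrite !scalerA divff ?factK0 // !scale1r.
Qed.

End GeneralizedBernoulliTheory.

Definition trinomial (K : fieldType) (n k l m : nat) : K :=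
  n`!%:R / (k`!%:R * l`!%:R * m`!%:R).

(* Main.v *)
From HB Require Import structures.
Require Import Defs.
From mathcomp Require Import all_boot all_order all_algebra all_field.
From mathcomp Require Import boolp reals ring.

Import Order.TTheory GRing.Theory Num.Theory.
Local Open Scope ring_scope.

(** Let [F_eta(x,t)] be the exponential generating series of the polynomials
    [B_(n,chi,eta)(x)]; it factors as [F_eta(0,t) e^(xt)]. Both sides of the
    identity are [n!] times the coefficient of [t^n] in a product of three
    series [F_(xi^w)(x, wt)], and both products consist of the same six
    factors: [F_(xi^w)(0, wt)] for [w = w1, w2, w3], and [e^(w w' y t)] for
    the three pairs [w, w']. *)

Section PowerSeriesRing.
Variable A : comNzRingType.
Implicit Types f g h : nat -> A.

Lemma fps_mulC : commutative (@fps_mul A).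
Proof.
move=> f g; apply/funext => n; rewrite /fps_mul (reindex_inj rev_ord_inj) /=.
by apply: eq_bigr => i _; rewrite subSS mulrC subKn // -ltnS.
Qed.

(** Only coefficients of index at most n enter, so truncating at [N] loses nothing. The ring laws of
    series thus follow from those of polynomials. *)
Lemma fps_mul_coef f g N n : (n < N)%N ->
  fps_mul f g n = ((\poly_(i < N) f i) * (\poly_(i < N) g i))`_n.
Proof.
move=> lt_nN; rewrite coefM; apply: eq_bigr => i _.
rewrite !coef_poly (leq_ltn_trans (leq_subr _ _) lt_nN).
by rewrite (leq_trans (ltn_ord i) lt_nN).
Qed.

Lemma fps_mul3_coef f g h N n : (n < N)%N ->
  fps_mul (fps_mul f g) h n =
  ((\poly_(i < N) f i) * (\poly_(i < N) g i) * (\poly_(i < N) h i))`_n.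
Proof.
move=> lt_nN; rewrite coefM; apply: eq_bigr => i _.
have lt_iN := leq_trans (ltn_ord i) lt_nN.
rewrite (fps_mul_coef _ _ _ _ lt_iN) [in RHS]coef_poly.
by rewrite (leq_ltn_trans (leq_subr _ _) lt_nN).
Qed.

Lemma fps_mulA : associative (@fps_mul A).
Proof.
move=> f g h; rewrite fps_mulC; apply/funext => n.
by rewrite !(fps_mul3_coef _ _ _ _ _ (ltnSn n)) mulrC mulrA.
Qed.

Lemma fps_mul1f : left_id (fps_one A) (@fps_mul A).
Proof.
move=> f; apply/funext => n; rewrite /fps_mul big_ord_recl subn0 mul1r.
by rewrite big1 ?addr0 // => i _; rewrite mul0r.
Qed.

(** This makes [AC] reordering available for products of series. *)
HB.instance Definition _ := Monoid.isComLaw.Build (nat -> A) (fps_one A)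
  (@fps_mul A) fps_mulA fps_mulC fps_mul1f.

Lemma fps_mul3E f g h n :
  fps_mul (fps_mul f g) h n =
  \sum_(k < n.+1) \sum_(l < n.+1) \sum_(m < n.+1 | (k + l + m == n)%N)
    f k * g l * h m.
Proof.
rewrite -fps_mulA; apply: eq_bigr => k _.
have le_kn : (k <= n)%N by rewrite -ltnS.
rewrite /fps_mul mulr_sumr.
(* For k + l <= n exactly one m completes the sum to n. For larger l there is none, so the widened
   range adds only zeros. *)
rewrite (big_ord_widen n.+1 (fun l => f k * (g l * h (n - k - l)%N))).
  rewrite big_mkcond /=; apply: eq_bigr => l _; case: ifPn => [lt_l | ].
    have le_kln : (k + l <= n)%N by rewrite -leq_subRL.
    rewrite (big_pred1 (inord (n - k - l))); last first.
      move=> m; rewrite /= -val_eqE /= inordK -subnDA ?ltnS ?leq_subr //.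
      by rewrite -(eqn_add2l (k + l) m) subnKC.
    by rewrite inordK ?mulrA // -subnDA ltnS leq_subr.
  rewrite ltnS -ltnNge => lt_l; rewrite big1 // => m /eqP def_n.
  by move: lt_l; rewrite ltnNge leq_subRL // -[X in (_ <= X)%N]def_n leq_addr.
by rewrite ltnS leq_subr.
Qed.

(** Substituting ct for t respects products, since c^n = c^i c^(n-i). *)
Lemma fps_mul_scale c f g n :
  fps_mul f g n * c ^+ n =
  fps_mul (fun i => f i * c ^+ i) (fun i => g i * c ^+ i) n.
Proof.
rewrite /fps_mul mulr_suml; apply: eq_bigr => i _.
by rewrite mulrACA -exprD subnKC // -ltnS.
Qed.

End PowerSeriesRing.

Lemma rmorph_fps_mul (A B : comNzRingType) (phi : {rmorphism A -> B}) f g :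
  phi \o fps_mul f g = fps_mul (phi \o f) (phi \o g).
Proof.
apply/funext => n /=; rewrite /fps_mul rmorph_sum.
by apply: eq_bigr => i _; rewrite rmorphM.
Qed.

Section TwistedBernoulli.
Variables (K : fieldType) (d : nat) (chi : int -> K).
Hypotheses (charK : [pchar K] =i pred0) (d_gt0 : (0 < d)%N).
Implicit Types eta x c : K.

Definition exp_coef x n : K := (n`!%:R)^-1 * x ^+ n.

Definition bernoulli_egf eta x n : K :=
  (n`!%:R)^-1 * (gen_bernoulli d chi eta n).[x].

(** Multiplied by eta^d e^(dt) - 1, both sides become t e^(xt) times the character sum [S]; this
    denominator [D] can be cancelled even when eta^d = 1. *)
Lemma bernoulli_egf_exp eta x :
  bernoulli_egf eta x = fps_mul (bernoulli_egf eta 0) (exp_coef x).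
Proof.
pose b n := (n`!%:R)^-1 *: gen_bernoulli d chi eta n.
have hb z : horner_eval z \o b = bernoulli_egf eta z.
  by apply/funext => n; rewrite /= /horner_eval hornerZ.
pose S n : K := \sum_(0 <= a < d) chi a%:Z * eta ^+ a * exp_coef a%:R n.
pose D n : K := eta ^+ d * exp_coef d%:R n - fps_one K n.
have hexp (a : nat) n z : (fps_exp (a%:R : {poly K}) n).[z] = exp_coef a%:R n.
  by rewrite /fps_exp hornerZ hornerE -polyC_natr hornerC.
(* The denominator is constant in x, so every evaluation gives the same [D]. *)
have hD z : horner_eval z \o bernoulli_den d eta = D.
  apply/funext => n; rewrite /= /horner_eval /bernoulli_den.
  by rewrite hornerD hornerN hornerZ hexp /fps_one -polyC_natr hornerC.
have DbE z : fps_mul D (bernoulli_egf eta z) =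
    fps_mul (fps_mul (fps_t K) (exp_coef z)) S.
  have /(congr1 (fun u => horner_eval z \o u)) :=
    gen_bernoulliP chi eta charK d_gt0.
  rewrite /= /bernoulli_num !rmorph_fps_mul hD hb => ->.
  congr (fps_mul (fps_mul _ _) _); apply/funext => n /=; rewrite /horner_eval.
  - by rewrite /fps_t -polyC_natr hornerC.
  - by rewrite /fps_exp hornerZ horner_exp hornerX.
  by rewrite horner_sum; apply: eq_bigr => a _; rewrite hornerZ hexp.
have exp0 : exp_coef 0 = fps_one K.
  apply/funext => -[|n]; rewrite /exp_coef /fps_one ?expr0 ?fact0 ?invr1 ?mulr1 //.
  by rewrite expr0n mulr0.
(* If eta^d = 1, the constant term of [D] vanishes; cancellation relies on the first nonzero
   coefficient, of index [m]. It comes from a unit of K[x], whose value at 0 is nonzero. *)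
have [m [Du D0 _]] := bernoulli_den_order chi eta charK d_gt0.
have Dm i : D i = horner_eval 0 (bernoulli_den d eta i) by rewrite -(hD 0).
apply: (@fps_mulI _ m D).
- by rewrite Dm -unitfE rmorph_unit.
- by move=> i /D0 D0i; rewrite Dm D0i rmorph0.
by rewrite DbE fps_mulA DbE exp0 Monoid.mulm1 -!fps_mulA (fps_mulC _ S).
Qed.

(** The series F_eta(0,ct). *)
Definition bernoulli_factor eta c n : K := bernoulli_egf eta 0 n * c ^+ n.

Lemma bernoulli_egf_scale eta x c :
  (fun n => bernoulli_egf eta x n * c ^+ n) =
  fps_mul (bernoulli_factor eta c) (exp_coef (x * c)).
Proof.
apply/funext => n; rewrite bernoulli_egf_exp fps_mul_scale.
by congr (fps_mul _ _ n); apply/funext => i; rewrite /exp_coef exprMn mulrA.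
Qed.

(** The trinomial coefficient is n! times the three inverse factorials that normalise the
    coefficients of the series F_eta(x,ct). *)
Lemma trinomial_bernoulli_sum eta1 eta2 eta3 x1 x2 x3 c1 c2 c3 n :
  let B k eta x := (gen_bernoulli d chi eta k).[x] in
  \sum_(k < n.+1) \sum_(l < n.+1) \sum_(m < n.+1 | (k + l + m == n)%N)
     trinomial K n k l m * B k eta1 x1 * B l eta2 x2 * B m eta3 x3
     * c1 ^+ k * c2 ^+ l * c3 ^+ m
  = n`!%:R *
    fps_mul (fps_mul
      (fps_mul (bernoulli_factor eta1 c1) (exp_coef (x1 * c1)))
      (fps_mul (bernoulli_factor eta2 c2) (exp_coef (x2 * c2))))
      (fps_mul (bernoulli_factor eta3 c3) (exp_coef (x3 * c3))) n.
Proof.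
rewrite -!bernoulli_egf_scale fps_mul3E /= mulr_sumr.
apply: eq_bigr => k _; rewrite mulr_sumr; apply: eq_bigr => l _.
rewrite mulr_sumr; apply: eq_bigr => m _.
rewrite /trinomial /bernoulli_egf !invfM -!mulrA; congr (_ * _).
set u := _.[x1]; set v := _.[x2]; set w := _.[x3].
ring.
Qed.

End TwistedBernoulli.

Theorem theorem4p7 (R : realType) (p : nat) (p_prime : prime p)
    (C : padic_complex R p)
    (xi : Cp C) (xi_ramified : ramified_root p xi)
    (d : nat) (d_gt0 : (0 < d)%N)
    (chi : int -> algC) (chi_primitive : is_primitive_character d chi)
    (iota : {rmorphism algC -> Cp C})
    (w1 w2 w3 : nat) (w1_gt0 : (0 < w1)%N) (w2_gt0 : (0 < w2)%N)
    (w3_gt0 : (0 < w3)%N)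
    (n : nat) (y : Cp C) (y_Zp : in_Zp y) :
  let B (k : nat) (eta x : Cp C) : Cp C :=
    (gen_bernoulli d (fun a => iota (chi a)) eta k).[x] in
  \sum_(k < n.+1) \sum_(l < n.+1) \sum_(m < n.+1 | (k + l + m == n)%N)
     trinomial (Cp C) n k l m
     * B k (xi ^+ w3) (w1%:R * y)
     * B l (xi ^+ w1) (w2%:R * y)
     * B m (xi ^+ w2) (w3%:R * y)
     * w3%:R ^+ k * w1%:R ^+ l * w2%:R ^+ m
  =
  \sum_(k < n.+1) \sum_(l < n.+1) \sum_(m < n.+1 | (k + l + m == n)%N)
     trinomial (Cp C) n k l m
     * B k (xi ^+ w2) (w1%:R * y)
     * B l (xi ^+ w1) (w3%:R * y)
     * B m (xi ^+ w3) (w2%:R * y)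
     * w2%:R ^+ k * w1%:R ^+ l * w3%:R ^+ m.
Proof.
have charK : [pchar Cp C] =i pred0.
  by move=> q; rewrite (fmorph_pchar iota) pchar_num.
rewrite /= !trinomial_bernoulli_sum //; congr (_ * _ n).
(* Each exponent is put in the form w_i w_j y with i < j, so that the exponentials on the two sides
   agree literally. *)
rewrite -![_%:R * y * _]mulrA ![y * _]mulrC !mulrA.
rewrite (mulrC w2%:R w1%:R) (mulrC w3%:R w1%:R) (mulrC w3%:R w2%:R).
(* The third factor F_(xi^w1)(0, w1 t) and the sixth, e^(w2 w3 y t), stay in place; the other four
   are exchanged in pairs. *)
by rewrite (@fps_mul _).[AC ((2*2)*2) (((5*4)*(3*2))*(1*6))].
Qed.
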